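(* Let $f:\mathbb{R}\to\mathbb{R}$ be given by $f(\xi)=1$ if $\xi<0$ and $f(\xi)=0$ if $\xi\ge0$. Fix $t>0$ and let $a,b>0$ be given. For $N\in\mathbb{N}$ and $j=1,\dots,N$ define $$J_N:=\left\lceil\frac{(N-1)b}{a+b}\right\rceil,\qquad x_j^N:=\begin{cases}a+t&\text{if }j\le J_N,\\-b&\text{if }j>J_N,\end{cases}$$ where $\lceil x\rceil$ is the smallest integer greater than or equal to $x$. Then for all sufficiently large $N$ there are at least three solutions $(\sigma_1,\dots,\sigma_N)\in\mathbb{R}^N$ of the $N$-player Nash equilibrium condition $$\sigma_i=f\left(\frac{1}{N-1}\sum_{j\ne i}(x_j^N-\sigma_jt)\right),\qquad i=1,\dots,N,$$ which are given by (1) $\sigma_i=0$ for $i=1,\dots,N$; (2) $\sigma_i=1$ for $i=1,\dots,N$; and (3) $\sigma_i=1$ for $i=1,\dots,J_N$ and $\sigma_i=0$ for $i=J_N+1,\dots,N$.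
   Context: The displayed condition is the $N$-player Nash system $\sigma_i=\sigma_0\big(\frac1{N-1}\sum_{j\ne i}\delta_{x(0,t,\sigma_j,x_j)}\big)$, $i=1,\dots,N$, in dimension $d=1$, for the optimal trajectories $x(0,t,\sigma,x)=x-\sigma t$ and the coupling $\sigma_0(m)=f\big(\int_{\mathbb{R}}x\,dm(x)\big)$. *)

(* Defs.v *)
From mathcomp Require Import all_boot all_order all_algebra.
From mathcomp Require Import reals.

Set Implicit Arguments.
Unset Strict Implicit.
Unset Printing Implicit Defensive.

Import Order.TTheory GRing.Theory Num.Theory.
Local Open Scope ring_scope.

Definition coupling (R : realType) (xi : R) : R := if xi < 0 then 1 else 0.

(* The players 1, ..., N of the text are the ordinals 0, ..., N - 1 here, so   *)
(* the player called j in the text has j = i.+1 for the ordinal i.             *)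

(* N%:R - 1 is the real subtraction, so J_N is also meaningful for N = 0.      *)
Definition JN (R : realType) (a b : R) (N : nat) : int :=
  Num.ceil ((N%:R - 1) * b / (a + b)).

Definition in_first_group (R : realType) (a b : R) (N : nat) (i : 'I_N) : bool :=
  i.+1%:Z <= JN a b N.

Definition initial_position (R : realType) (t a b : R) (N : nat) : 'rV[R]_N :=
  \row_(i < N) (if in_first_group a b i then a + t else - b).

(* The point x - sigma t is the optimal trajectory x(0, t, sigma, x), so the   *)
(* argument of f is the mean of the empirical measure of the other players at  *)
(* time t.                                                                     *)
Definition nash_equilibrium (R : realType) (f : R -> R) (t : R) (N : nat)
    (x sigma : 'rV[R]_N) : Prop :=
  forall i : 'I_N,
    sigma 0 i =
      f (1 / (N%:R - 1) * \sum_(j < N | j != i) (x 0 j - sigma 0 j * t)).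

(* Main.v *)
(**
  Let [k] be the size J_N of the first group. By definition of the ceiling,
  [(N - 1) b <= k (a + b) < (N - 1) b + (a + b)]. In state (3) the two groups
  sit at [a] and [- b], and the sum over the players other than [i] equals
  [k (a + b) - (N - 1) b], minus [a + b] when [i] is in the first group: the two
  inequalities are precisely the equilibrium conditions. State (1) moves the
  first group by [+ t] and state (2) moves the second group by [- t]. This
  only helps half of the players; for the other half the gain is [(k - 1) t],
  respectively [(N - 1 - k) t], which exceeds [a + b] for large [N] since both
  group sizes grow linearly in [N].
*)
Require Import Defs.
From mathcomp Require Import all_boot all_order all_algebra.
From mathcomp Require Import reals.
From mathcomp Require Import lra.

Set Implicit Arguments.
Unset Strict Implicit.
Unset Printing Implicit Defensive.

Import Order.TTheory GRing.Theory Num.Theory.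
Local Open Scope ring_scope.

Lemma sum_two_groups (R : pzRingType) (N k : nat) (p q : R) : (k <= N)%N ->
  \sum_(j < N) (if (j < k)%N then p else q) = k%:R * p + (N%:R - k%:R) * q.
Proof.
move=> /subnKC; set m := (N - k)%N => <-.
rewrite big_split_ord /= natrD addrAC subrr add0r; congr (_ + _).
  under eq_bigr => j _ do rewrite ltn_ord.
  by rewrite sumr_const card_ord mulr_natl.
under eq_bigr => j _ do rewrite ltnNge leq_addr /=.
by rewrite sumr_const card_ord mulr_natl.
Qed.

(** [coupling] sees only the sign of its argument, so the positive factor [1 / (N%:R - 1)] drops
    out. *)
Lemma coupling_mean (R : realType) (N : nat) (s : R) : (1 < N)%N ->
  coupling (1 / (N%:R - 1) * s) = if s < 0 then 1 else 0.
Proof.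
move=> N_gt1; rewrite /coupling pmulr_rlt0 // divr_gt0 // subr_gt0.
by rewrite ltr1n.
Qed.

(** The sum over the others is the full sum [s] minus player [i]'s own term, [p] or [q]. Hence the N
    conditions collapse to one per group. *)
Lemma nash_two_groups (R : realType) (t p q u v : R) (N k : nat)
    (x sigma : 'rV[R]_N) :
  (1 < N)%N -> (k <= N)%N ->
  (forall j, sigma 0 j = if (j < k)%N then u else v) ->
  (forall j, x 0 j - sigma 0 j * t = if (j < k)%N then p else q) ->
  let s := k%:R * p + (N%:R - k%:R) * q in
  u = (if s - p < 0 then 1 else 0) -> v = (if s - q < 0 then 1 else 0) ->
  nash_equilibrium (@coupling R) t x sigma.
Proof.
move=> N_gt1 le_kN sigmaE posE s uE vE i.
rewrite coupling_mean // sigmaE.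
under eq_bigr => j _ do rewrite posE.
have := sum_two_groups p q le_kN; rewrite (bigD1 i) //= -/s => /(canRL (addKr _)) ->.
by rewrite addrC; case: ifP => _.
Qed.

Lemma first_group_size (R : realType) (a b : R) (N : nat) :
  0 < a -> 0 < b -> (1 < N)%N ->
  exists k : nat, [/\ (0 < k < N)%N,
    forall i : 'I_N, in_first_group a b i = (i < k)%N,
    (N%:R - 1) * b <= k%:R * (a + b) & k%:R * (a + b) < (N%:R - 1) * b + (a + b)].
Proof.
move=> a_gt0 b_gt0 N_gt1; have ab_gt0 : 0 < a + b by rewrite addr_gt0.
have n_gt0 : 0 < N%:R - 1 :> R by rewrite subr_gt0 ltr1n.
have c_gt0 : 0 < (N%:R - 1) * b / (a + b) by rewrite divr_gt0 ?mulr_gt0.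
have J_ge0 : 0 <= JN a b N.
  by rewrite -(ler_int R) (le_trans (ltW c_gt0)) // Num.Theory.ceil_ge.
case JE: (JN a b N) J_ge0 => [k|//] _; exists k.
have cE : (N%:R - 1) * b / (a + b) * (a + b) = (N%:R - 1) * b.
  by rewrite divfK // gt_eqF.
have le_ck : (N%:R - 1) * b / (a + b) <= k%:R.
  by rewrite -[k%:R]/((Posz k)%:~R) -JE Num.Theory.ceil_ge.
have lt_kc : k%:R < (N%:R - 1) * b / (a + b) + 1.
  rewrite -ltrBlDr.
  have := Num.Theory.ceilB1_lt ((N%:R - 1) * b / (a + b)).
  by rewrite -/(JN a b N) JE intrD.
have lower : (N%:R - 1) * b <= k%:R * (a + b) by rewrite -cE ler_pM2r.
have upper : k%:R * (a + b) < (N%:R - 1) * b + (a + b).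
  by move: lt_kc; rewrite -(ltr_pM2r ab_gt0) mulrDl mul1r cE.
split=> //; last by move=> i; rewrite /in_first_group JE.
(* For [k < N], compare after multiplying by [a + b]: [N%:R * (a + b)] exceeds the bound in [upper]
   by [(N%:R - 1) * a]. *)
rewrite -(ltr_nat R) (lt_le_trans c_gt0) //= -(ltr_nat R).
rewrite -(ltr_pM2r ab_gt0) (lt_le_trans upper) //.
have := mulr_gt0 n_gt0 a_gt0; lra.
Qed.

Lemma eventually_natr_ge (R : realType) (K : R) :
  exists N0 : nat, forall N : nat, (N0 <= N)%N -> K <= N%:R.
Proof.
exists (Num.truncn K).+1 => N le_N; apply: le_trans (ltW (truncnS_gt K)) _.
by rewrite ler_nat.
Qed.

Theorem proposition2p11 (R : realType) (t a b : R)
    (t_gt0 : 0 < t) (a_gt0 : 0 < a) (b_gt0 : 0 < b) :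
  exists N0 : nat, forall N : nat, (N0 <= N)%N ->
    let x := initial_position t a b N in
    let sigma1 : 'rV[R]_N := \row_(i < N) 0 in
    let sigma2 : 'rV[R]_N := \row_(i < N) 1 in
    let sigma3 : 'rV[R]_N :=
      \row_(i < N) (if in_first_group a b i then 1 else 0) in
    [/\ nash_equilibrium (@coupling R) t x sigma1,
        nash_equilibrium (@coupling R) t x sigma2,
        nash_equilibrium (@coupling R) t x sigma3
      & [/\ sigma1 <> sigma2, sigma1 <> sigma3 & sigma2 <> sigma3]].
Proof.
have ab_gt0 : 0 < a + b by rewrite addr_gt0.
(* Dividing by [a + b], the term [(a + b) / t] yields the required gain [a + b] after multiplication
   by [t]. The summand 1 pays for the player's own term in [k%:R - 1], and for the rounding up of
   the ceiling in [N%:R - 1 - k%:R]. *)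
pose M := (a + b) * (1 + (a + b) / t).
have [N1 N1P] := eventually_natr_ge (M / b + 1).
have [N2 N2P] := eventually_natr_ge (M / a + 1).
exists (maxn 2 (maxn N1 N2)) => N; rewrite !geq_max.
move=> /and3P[N_gt1 /N1P MbN /N2P MaN] x sigma1 sigma2 sigma3.
have [k [/andP[k_gt0 lt_kN] groupE lower upper]] :=
  first_group_size a_gt0 b_gt0 N_gt1.
have le_kN := ltnW lt_kN.
have {}MbN : M <= (N%:R - 1) * b by rewrite -ler_pdivrMr // lerBrDr.
have {}MaN : M <= (N%:R - 1) * a by rewrite -ler_pdivrMr // lerBrDr.
have kt_ge : a + b <= (k%:R - 1) * t.
  rewrite -ler_pdivrMr // lerBrDl -(ler_pM2r ab_gt0).
  by rewrite [X in X <= _]mulrC (le_trans MbN).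
have nkt_ge : a + b <= (N%:R - 1 - k%:R) * t.
  rewrite -ler_pdivrMr // -(ler_pM2r ab_gt0).
  move: MaN; rewrite /M mulrDr mulr1 [X in _ <= X -> _]mulrC; lra.
have xE j : x 0 j = if (j < k)%N then a + t else - b by rewrite mxE groupE.
have sigma3E j : sigma3 0 j = if (j < k)%N then 1 else 0 by rewrite mxE groupE.
split; last first.
  (* Both groups are nonempty: [i0] lies in the first and separates [sigma1] from the other two;
     [ik] lies in the second and separates [sigma2] from [sigma3]. *)
  pose i0 : 'I_N := Ordinal (ltn_trans k_gt0 lt_kN); pose ik := Ordinal lt_kN.
  by split=> /rowP; [move=> /(_ i0) | move=> /(_ i0) | move=> /(_ ik)];
    rewrite ?sigma3E !mxE /= ?k_gt0 ?ltnn => /eqP; rewrite ?oner_eq0 // eq_sym oner_eq0.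
- apply: (nash_two_groups (p := a) (q := - b) (u := 1) (v := 0)) le_kN _ _ _ _ => //.
  + by move=> j; rewrite xE sigma3E; case: ifP => _; lra.
  + by rewrite ifT //; lra.
  (* [lower] may be an equality; this is harmless because [coupling] is 0 at 0. *)
  + by rewrite ifF //; apply/negbTE; rewrite -leNgt; lra.
- apply: (nash_two_groups (p := a) (q := - b - t) (u := 1) (v := 1)) le_kN _ _ _ _ => //.
  + by move=> j; rewrite mxE if_same.
  + by move=> j; rewrite xE mxE; case: ifP => _; lra.
  + by rewrite ifT //; lra.
  + by rewrite ifT //; lra.
- apply: (nash_two_groups (p := a + t) (q := - b) (u := 0) (v := 0)) le_kN _ _ _ _ => //.
  + by move=> j; rewrite mxE if_same.
  + by move=> j; rewrite xE mxE; case: ifP => _; lra.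
  + by rewrite ifF //; apply/negbTE; rewrite -leNgt; lra.
  + by rewrite ifF //; apply/negbTE; rewrite -leNgt; lra.
Qed.
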